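(* Let $n\ge 1$, let $\underline{P}$ be a third-order stochastic tensor of dimension $n$ with flattening $R\in\mathbb{R}^{n\times n^2}$, let $0\le\alpha<\tfrac12$, let $v\in\mathbb{R}^n$ be a stochastic vector, and let $\mathcal{F}(x)=x-\alpha R(x\otimes x)-(1-\alpha)v$. Let $(n_i)_{i\ge 0}$ be any sequence of positive integers. Suppose that a vector $x_{0,0}\in\mathbb{R}^n$ is such that (i) $\mathcal{F}(x_{0,0})\le 0$, (ii) $0\le x_{0,0}$ and $e^Tx_{0,0}\le 1$. Then the modified Newton algorithm $$x_{i,s}=x_{i,s-1}-\bigl(I-\alpha R(x_{i,0}\otimes I+I\otimes x_{i,0})\bigr)^{-1}\mathcal{F}(x_{i,s-1}),\quad s=1,2,\dots,n_i,\qquad x_{i+1,0}=x_{i,n_i},\qquad i=0,1,2,\dots,$$ started from $x_{0,0}$, generates (that is, all the inverses exist) a sequence $\{x_k\}_{k\ge0}$, where $x_k:=x_{k,0}$, such that $x_k\le x_{k+1}$ for all $k\ge 0$, and $\lim_{k\to\infty}\mathcal{F}(x_k)=0$.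
   Context: A third-order stochastic tensor of dimension $n$ is an array $\underline{P}=(\underline{P}_{ijk})_{1\le i,j,k\le n}$ of nonnegative reals with $\sum_{i=1}^n\underline{P}_{ijk}=1$ for all $j,k$. Its flattening along the first index is the $n\times n^2$ matrix $R$ whose $i$th row is $(\underline{P}_{i11},\dots,\underline{P}_{in1},\underline{P}_{i12},\dots,\underline{P}_{in2},\dots,\underline{P}_{i1n},\dots,\underline{P}_{inn})$; thus $R$ is entrywise nonnegative with all column sums equal to $1$. A stochastic vector is a nonnegative vector whose entries sum to $1$. $\otimes$ is the Kronecker product, with vectors regarded as column vectors, so that $x\otimes x\in\mathbb{R}^{n^2}$ and $x\otimes I,\ I\otimes x\in\mathbb{R}^{n^2\times n}$ for $x\in\mathbb{R}^n$. $I$ is the $n\times n$ identity matrix, and $e=(1,\dots,1)^T\in\mathbb{R}^n$. Inequalities between vectors are entrywise. The matrix $I-\alpha R(x\otimes I+I\otimes x)$ is the Fréchet derivative $\mathcal{F}'_x$ of $\mathcal{F}$ at $x$. The equation $\mathcal{F}(x)=0$ is the multilinear PageRank equation for a third-order tensor. *)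

(* Defs.v *)
From mathcomp Require Export all_boot all_order all_algebra.
From mathcomp Require Export all_classical all_reals all_analysis.
From mathcomp Require Export mxtens.
Set Implicit Arguments.
Unset Strict Implicit.
Unset Printing Implicit Defensive.
Import Order.TTheory GRing.Theory Num.Theory.

Local Open Scope ring_scope.

Section MultilinearPageRank.
Context {R : realType} {n : nat}.

(* [P i j k] is the entry P_{ijk}; stochasticity is in the first index. *)
Definition stochastic_tensor (P : 'I_n -> 'I_n -> 'I_n -> R) : Prop :=
  (forall i j k, 0 <= P i j k) /\ (forall j k, \sum_(i < n) P i j k = 1).

(* Row i is (P_{i11}, ..., P_{in1}, ..., P_{i1n}, ..., P_{inn}): the last index
   k is the outer (slow) one, and [mxtens_unindex] sends column k * n + j to
   the pair (k, j), as in the Kronecker product [*t]. *)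
Definition flattening (P : 'I_n -> 'I_n -> 'I_n -> R) : 'M[R]_(n, n * n) :=
  \matrix_(i < n, c < n * n)
    P i (mxtens_unindex c).2 (mxtens_unindex c).1.

Definition lecv (x y : 'cV[R]_n) : Prop := forall i, x i 0 <= y i 0.

Definition stochastic_vector (v : 'cV[R]_n) : Prop :=
  lecv 0 v /\ \sum_(i < n) v i 0 = 1.

(* The column counts 1 * n and n * 1 of the Kronecker products are only
   propositionally equal to n. *)
Definition tens_vecI (x : 'cV[R]_n) : 'M[R]_(n * n, n) :=
  castmx (erefl, mul1n n) (x *t (1%:M : 'M[R]_n)).

Definition tens_Ivec (x : 'cV[R]_n) : 'M[R]_(n * n, n) :=
  castmx (erefl, muln1 n) ((1%:M : 'M[R]_n) *t x).

Definition pagerank_fun (alpha : R) (Q : 'M[R]_(n, n * n)) (v x : 'cV[R]_n) :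
    'cV[R]_n :=
  x - alpha *: (Q *m (x *t x)) - (1 - alpha) *: v.

Definition pagerank_deriv (alpha : R) (Q : 'M[R]_(n, n * n)) (x : 'cV[R]_n) :
    'M[R]_n :=
  1%:M - alpha *: (Q *m (tens_vecI x + tens_Ivec x)).

Section ModifiedNewton.
Variables (alpha : R) (Q : 'M[R]_(n, n * n)) (v : 'cV[R]_n).
Variables (ns : nat -> nat) (x00 : 'cV[R]_n).

(* [invmx A] is the inverse of A only when [A \in unitmx]. *)
Definition newton_step (z y : 'cV[R]_n) : 'cV[R]_n :=
  y - invmx (pagerank_deriv alpha Q z) *m pagerank_fun alpha Q v y.

Fixpoint newton_outer (i : nat) : 'cV[R]_n :=
  if i is i'.+1 then
    iter (ns i') (newton_step (newton_outer i')) (newton_outer i')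
  else x00.

(* [modified_newton i s] is x_{i,s}. *)
Definition modified_newton (i s : nat) : 'cV[R]_n :=
  iter s (newton_step (newton_outer i)) (newton_outer i).

Lemma modified_newton00 : modified_newton 0 0 = x00.
Proof. by []. Qed.

Lemma modified_newtonS i s :
  modified_newton i s.+1 = modified_newton i s
    - invmx (pagerank_deriv alpha Q (modified_newton i 0))
        *m pagerank_fun alpha Q v (modified_newton i s).
Proof. by []. Qed.

Lemma modified_newton_next i :
  modified_newton i.+1 0 = modified_newton i (ns i).
Proof. by []. Qed.

End ModifiedNewton.
End MultilinearPageRank.

(* Main.v *)
Require Import Defs.
From mathcomp Require Import ring lra.
Set Implicit Arguments.
Unset Strict Implicit.
Unset Printing Implicit Defensive.
Import Order.TTheory GRing.Theory Num.Theory.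
Import numFieldNormedType.Exports.
Local Open Scope classical_set_scope.
Local Open Scope ring_scope.

(** The whole argument is controlled by one scalar, the mass e^T x.

    Write B(x, y) = Q (x ⊗ y).  It is bilinear, preserves nonnegativity, and,
    the columns of Q having sum 1, multiplies masses:
    e^T B(x, y) = (e^T x) (e^T y).  The derivative of F at z is I - M_z with
    M_z d = alpha (B(z, d) + B(d, z)).  If z >= 0 has mass at most 1, then M_z
    preserves nonnegativity and multiplies the mass of a nonnegative vector by
    2 alpha (e^T z) <= 2 alpha < 1, so I - M_z is invertible with a nonnegative
    inverse ([subI_monotone], [subI_unit]).

    Call y a subsolution if y >= 0, e^T y <= 1 and F(y) <= 0.  Let z be the
    point at which the derivative is taken, y >= z a subsolution, and y + d the
    next iterate.  Then (I - M_z) d = - F(y) >= 0, so d >= 0, and by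
    bilinearity
      F(y + d) = - alpha (B(y - z, d) + B(d, y - z) + B(d, d)) <= 0
    ([pagerank_fun_step]).  Taking masses in (I - M_z) d = - F(y), with
    s = e^T z and t = e^T y, gives
      (1 - 2 alpha s) e^T d = (1 - t) (1 - alpha - alpha t),
    from which 0 <= 1 - e^T (y + d) <= 2 alpha (1 - t).  So y + d is again a
    subsolution, and the mass defect 1 - e^T y is multiplied by at most
    2 alpha at each inner step ([newton_step_subsolution]).

    Finally, - F(y) >= 0 has mass (1 - t) (1 - alpha - alpha t) <= 1 - t, so
    the norm of the residual at a subsolution is at most its mass defect
    ([norm_pagerank_fun_le]).  As each outer step contains at least one inner
    step, the residuals F(x_k) tend to 0 at least as fast as (2 alpha)^k. *)

(** * Mass of a vector *)

Definition mass {R : realType} {n : nat} (x : 'cV[R]_n) : R :=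
  \sum_(i < n) x i 0.

Section Mass.
Context {R : realType} {n : nat}.
Implicit Types x y : 'cV[R]_n.

Lemma massD x y : mass (x + y) = mass x + mass y.
Proof. by rewrite /mass -big_split; apply: eq_bigr => i _; rewrite mxE. Qed.

Lemma massN x : mass (- x) = - mass x.
Proof. by rewrite /mass -sumrN; apply: eq_bigr => i _; rewrite mxE. Qed.

Lemma massZ a x : mass (a *: x) = a * mass x.
Proof. by rewrite /mass mulr_sumr; apply: eq_bigr => i _; rewrite mxE. Qed.

Lemma mass_ge0 x : lecv 0 x -> 0 <= mass x.
Proof. by move=> x0; apply: sumr_ge0 => i _; have := x0 i; rewrite mxE. Qed.

Lemma mass_le x y : lecv x y -> mass x <= mass y.
Proof. by move=> xy; apply: ler_sum => i _; exact: xy. Qed.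

Lemma entry_le_mass x i : lecv 0 x -> x i 0 <= mass x.
Proof.
move=> x0; rewrite /mass (bigD1 i) //= lerDl; apply: sumr_ge0 => j _.
by have := x0 j; rewrite mxE.
Qed.

Lemma norm_le_mass x : lecv 0 x -> `|x| <= mass x.
Proof.
move=> x0; rewrite [`|x|]mx_normrE; apply: bigmax_le => [|[i j] _ /=].
  exact: mass_ge0.
rewrite (ord1 j) ger0_norm ?entry_le_mass //.
by have := x0 i; rewrite mxE.
Qed.

End Mass.

(** * Nonnegative matrices that contract mass *)

Section SubstochasticMatrix.
Context {R : realType} {n : nat} (M : 'M[R]_n) (c : R).
Hypothesis M_ge0 : forall d, lecv 0 d -> lecv 0 (M *m d).
Hypothesis M_mass : forall d, lecv 0 d -> mass (M *m d) <= c * mass d.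
Hypothesis c_lt1 : c < 1.

(** The negative part dm of d satisfies dm <= M dm, because
    d >= M d >= - M dm.  Since M shrinks masses by the factor c < 1, the mass
    of dm vanishes. *)
Lemma subI_monotone (d : 'cV[R]_n) : lecv 0 ((1%:M - M) *m d) -> lecv 0 d.
Proof.
move=> Md_ge0.
pose dm : 'cV[R]_n := \col_i Num.max 0 (- d i 0).
have dm_ge0 : lecv 0 dm by move=> i; rewrite !mxE le_max lexx.
have ddm_ge0 : lecv 0 (d + dm).
  by move=> i; rewrite !mxE -lerBlDl sub0r le_max lexx orbT.
have dm_le : lecv dm (M *m dm).
  move=> i; rewrite [dm i 0]mxE ge_max; apply/andP; split.
    by have := M_ge0 dm_ge0 i; rewrite mxE.
  have := Md_ge0 i; have := M_ge0 ddm_ge0 i; rewrite mulmxDr mulmxBl mul1mx.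
  move: (M *m d) (M *m dm) => Md Mdm; rewrite !mxE; lra.
have dm0 : mass dm <= 0.
  have := le_trans (mass_le dm_le) (M_mass dm_ge0).
  have := mass_ge0 dm_ge0; move: c_lt1; nra.
move=> i; rewrite mxE -oppr_le0; apply: le_trans dm0.
by apply: le_trans (entry_le_mass i dm_ge0); rewrite mxE le_max lexx orbT.
Qed.

(** Monotonicity applied to u and to - u shows that the kernel is trivial. *)
Lemma subI_unit : 1%:M - M \in unitmx.
Proof.
rewrite -unitmx_tr -row_free_unit; apply: inj_row_free => u uM.
have {}uM : (1%:M - M) *m u^T = 0.
  by rewrite -[LHS]trmxK trmx_mul trmxK uM trmx0.
have u_ge0 : lecv 0 u^T by apply: subI_monotone; rewrite uM => i.
have u_le0 : lecv 0 (- u^T).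
  by apply: subI_monotone; rewrite mulmxN uM oppr0 => i.
apply/rowP => i; apply/eqP; rewrite eq_le.
by have := u_ge0 i; have := u_le0 i; rewrite !mxE oppr_ge0 => -> ->.
Qed.

End SubstochasticMatrix.

(** * The bilinear map of a flattened tensor *)

Definition bilin {R : realType} {n : nat} (Q : 'M[R]_(n, n * n))
  (x y : 'cV[R]_n) : 'cV[R]_n := Q *m (x *t y).

Section Bilinear.
Context {R : realType} {n : nat} (Q : 'M[R]_(n, n * n)).
Implicit Types x y z d : 'cV[R]_n.

Lemma bilinDl x y z : bilin Q (x + y) z = bilin Q x z + bilin Q y z.
Proof.
rewrite /bilin -mulmxDr; congr (_ *m _); apply/matrixP => i j.
by rewrite !mxE mulrDl.
Qed.

Lemma bilinDr x y z : bilin Q x (y + z) = bilin Q x y + bilin Q x z.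
Proof.
rewrite /bilin -mulmxDr; congr (_ *m _); apply/matrixP => i j.
by rewrite !mxE mulrDr.
Qed.

Lemma tens_vecIE x i j k :
  tens_vecI x (mxtens_index (i, j)) k = x i 0 * (j == k)%:R.
Proof.
rewrite castmxE cast_ord_id !mxE !mxtens_indexK; congr (_ * _).
  by congr (x _ _); exact: ord1.
by congr (_ == _)%:R; apply: val_inj; rewrite /= modn_small.
Qed.

Lemma tens_IvecE x i j k :
  tens_Ivec x (mxtens_index (i, j)) k = x j 0 * (i == k)%:R.
Proof.
rewrite castmxE cast_ord_id !mxE !mxtens_indexK mulrC; congr (_ * _).
  by congr (x _ _); exact: ord1.
by congr (_ == _)%:R; apply: val_inj; rewrite /= divn1.
Qed.

Lemma bilin_tens_vecI x d : Q *m tens_vecI x *m d = bilin Q x d.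
Proof.
rewrite -mulmxA; congr (_ *m _); apply/matrixP => c j.
case: (mxtens_indexP c) => i1 i2; rewrite !mxE !mxtens_indexK !ord1 /=.
rewrite (bigD1 i2) //= big1 => [|k /negPf ki2]; rewrite tens_vecIE.
  by rewrite eqxx mulr1 addr0.
by rewrite eq_sym ki2 mulr0 mul0r.
Qed.

Lemma bilin_tens_Ivec x d : Q *m tens_Ivec x *m d = bilin Q d x.
Proof.
rewrite -mulmxA; congr (_ *m _); apply/matrixP => c j.
case: (mxtens_indexP c) => i1 i2; rewrite !mxE !mxtens_indexK !ord1 /=.
rewrite (bigD1 i1) //= big1 => [|k /negPf ki1]; rewrite tens_IvecE.
  by rewrite eqxx mulr1 addr0 mulrC.
by rewrite eq_sym ki1 mulr0 mul0r.
Qed.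

Lemma bilin_sumM alpha z d :
  alpha *: (Q *m (tens_vecI z + tens_Ivec z)) *m d
    = alpha *: (bilin Q z d + bilin Q d z).
Proof.
by rewrite -scalemxAl mulmxDr mulmxDl bilin_tens_vecI bilin_tens_Ivec.
Qed.

Lemma pagerank_derivM alpha z d :
  pagerank_deriv alpha Q z *m d = d - alpha *: (bilin Q z d + bilin Q d z).
Proof. by rewrite /pagerank_deriv mulmxBl mul1mx bilin_sumM. Qed.

Hypothesis Q_ge0 : forall i c, 0 <= Q i c.
Hypothesis Q_col : forall c, \sum_i Q i c = 1.

Lemma bilin_ge0 x y : lecv 0 x -> lecv 0 y -> lecv 0 (bilin Q x y).
Proof.
move=> x0 y0 i; rewrite !mxE sumr_ge0 // => c _; rewrite mulr_ge0 // mxE.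
rewrite mulr_ge0 //; last first.
  by have := y0 (mxtens_unindex c).2; rewrite mxE => h; rewrite (ord1 (_.2)).
by have := x0 (mxtens_unindex c).1; rewrite mxE => h; rewrite (ord1 (_.1)).
Qed.

Lemma mass_bilin x y : mass (bilin Q x y) = mass x * mass y.
Proof.
rewrite /mass; under eq_bigr do rewrite mxE.
rewrite exchange_big /=.
under eq_bigr => c _ do rewrite -mulr_suml Q_col mul1r mxE.
rewrite mulr_sum; apply: eq_bigr => c _; congr (x _ _ * y _ _); exact: ord1.
Qed.
End Bilinear.

(** * Modified Newton steps from a subsolution *)

Section NewtonStep.
Context {R : realType} {n : nat} (Q : 'M[R]_(n, n * n)) (alpha : R).
Context (v : 'cV[R]_n).
Hypothesis Q_ge0 : forall i c, 0 <= Q i c.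
Hypothesis Q_col : forall c, \sum_i Q i c = 1.
Hypothesis alpha_ge0 : 0 <= alpha.
Hypothesis alpha_lt : alpha < 1 / 2.
Hypothesis v_mass : mass v = 1.

Local Notation F := (pagerank_fun alpha Q v).
Local Notation D := (pagerank_deriv alpha Q).

Let M (z : 'cV[R]_n) : 'M[R]_n := alpha *: (Q *m (tens_vecI z + tens_Ivec z)).

Let M_ge0 z : lecv 0 z -> forall d, lecv 0 d -> lecv 0 (M z *m d).
Proof.
move=> z0 d d0 i; have := bilin_ge0 Q_ge0 z0 d0 i.
have := bilin_ge0 Q_ge0 d0 z0 i; rewrite bilin_sumM.
move: (bilin Q z d) (bilin Q d z) => a b; rewrite !mxE => b0 a0.
by rewrite mulr_ge0 // addr_ge0.
Qed.

Let M_mass z : mass z <= 1 ->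
  forall d, lecv 0 d -> mass (M z *m d) <= (2 * alpha) * mass d.
Proof.
move=> z1 d /mass_ge0 d0; rewrite bilin_sumM massZ massD !mass_bilin //.
have := mulr_ge0 alpha_ge0 d0; nra.
Qed.

Let alpha2_lt1 : 2 * alpha < 1. Proof. by move: alpha_lt; lra. Qed.

Lemma pagerank_deriv_unit z : lecv 0 z -> mass z <= 1 -> D z \in unitmx.
Proof.
by move=> z0 z1; exact: (subI_unit (M_ge0 z0) (M_mass z1) alpha2_lt1).
Qed.

Lemma pagerank_deriv_monotone z d : lecv 0 z -> mass z <= 1 ->
  lecv 0 (D z *m d) -> lecv 0 d.
Proof.
by move=> z0 z1; exact: (subI_monotone (M_ge0 z0) (M_mass z1) alpha2_lt1).
Qed.

(** With t = e^T x this is t - alpha t^2 - (1 - alpha), which vanishes at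
    t = 1. *)
Lemma mass_pagerank_fun x :
  mass (F x) = - ((1 - mass x) * (1 - alpha - alpha * mass x)).
Proof.
rewrite /pagerank_fun !massD !massN !massZ mass_bilin // v_mass; ring.
Qed.

(** The linear part of F(y + d) - F(y) is the derivative at y, whereas d solves
    the equation for the derivative at z; the two differ by the terms in
    y - z, and B(d, d) is the second-order term. *)
Lemma pagerank_fun_step z y d : D z *m d = - F y ->
  F (y + d)
    = - (alpha *: (bilin Q (y - z) d + bilin Q d (y - z) + bilin Q d d)).
Proof.
rewrite pagerank_derivM => Dd.
have yzd : bilin Q y d = bilin Q (y - z) d + bilin Q z d.
  by rewrite -bilinDl subrK.
have dyz : bilin Q d y = bilin Q d (y - z) + bilin Q d z.
  by rewrite -bilinDr subrK.
move: Dd; rewrite /pagerank_fun -/(bilin Q y y) -/(bilin Q (y + d) (y + d)).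
move: (y - z) yzd dyz => w yzd dyz; rewrite bilinDl !bilinDr yzd dyz.
move: (bilin Q _ _) (bilin Q _ _) (bilin Q _ _) (bilin Q _ _) (bilin Q _ _)
  (bilin Q _ _) => a1 a2 a3 a4 a5 a6 Dd.
apply/colP => i; move/colP/(_ i): Dd; rewrite !mxE; lra.
Qed.

Definition subsolution (x : 'cV[R]_n) : Prop :=
  [/\ lecv 0 x, mass x <= 1 & lecv (F x) 0].

(** The mass defect after the step, multiplied by 1 - 2 alpha s > 0, equals
    alpha (1 - t) (1 + t - 2 s), where s = e^T z <= t = e^T y <= 1; both bounds
    on the defect come from this identity. *)
Lemma newton_step_subsolution z y :
    lecv 0 z -> lecv z y -> subsolution y ->
  let y' := newton_step alpha Q v z y in
  [/\ subsolution y', lecv y y' & 1 - mass y' <= 2 * alpha * (1 - mass y)].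
Proof.
move=> z0 zy [y0 y1 Fy] y'.
have zy_mass := mass_le zy.
have z1 : mass z <= 1 by exact: le_trans y1.
have [d y'E Dd] : exists2 d, y' = y + d & D z *m d = - F y.
  exists (- (invmx (D z) *m F y)) => //.
  by rewrite mulmxN mulKVmx // pagerank_deriv_unit.
have d0 : lecv 0 d.
  apply: (@pagerank_deriv_monotone z) => // i; rewrite Dd.
  by have := Fy i; move: (F y) => w; rewrite !mxE oppr_ge0.
have mass_d : mass d * (1 - 2 * alpha * mass z)
    = (1 - mass y) * (1 - alpha - alpha * mass y).
  have := congr1 mass Dd.
  rewrite massN mass_pagerank_fun opprK pagerank_derivM massD massN massZ massD.
  by rewrite !mass_bilin // => <-; ring.
have Fy' : lecv (F y') 0.
  have yz0 : lecv 0 (y - z) by move=> i; rewrite !mxE subr_ge0.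
  move=> i; rewrite y'E (pagerank_fun_step Dd).
  have := bilin_ge0 Q_ge0 yz0 d0 i; have := bilin_ge0 Q_ge0 d0 yz0 i.
  have := bilin_ge0 Q_ge0 d0 d0 i.
  move: (bilin Q _ _) (bilin Q _ _) (bilin Q _ _) => a1 a2 a3.
  by rewrite !mxE => *; rewrite oppr_le0 mulr_ge0 // !addr_ge0.
have z_mass := mass_ge0 z0.
have den_gt0 : 0 < 1 - 2 * alpha * mass z.
  by move: alpha2_lt1 alpha_ge0; nra.
have gap_ge0 : 0 <= alpha * (1 - mass y) by rewrite mulr_ge0 // subr_ge0.
have gap_lower : 0 <= 1 - mass y'.
  rewrite -(pmulr_lge0 _ den_gt0) y'E massD.
  have -> : (1 - (mass y + mass d)) * (1 - 2 * alpha * mass z)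
    = alpha * (1 - mass y) * ((1 - mass z) + (mass y - mass z)).
    by move: mass_d; lra.
  by rewrite mulr_ge0 // addr_ge0 // subr_ge0.
have gap_upper : 1 - mass y' <= 2 * alpha * (1 - mass y).
  rewrite -subr_ge0 -(pmulr_lge0 _ den_gt0) y'E massD.
  have -> : (2 * alpha * (1 - mass y) - (1 - (mass y + mass d)))
              * (1 - 2 * alpha * mass z)
    = alpha * (1 - mass y)
      * ((1 - mass y) + 2 * mass z * (1 - 2 * alpha)).
    by move: mass_d; lra.
  by rewrite mulr_ge0 // addr_ge0 ?mulr_ge0 ?subr_ge0 // ltW.
split=> //.
- split=> //; last by rewrite -subr_ge0.
  by move=> i; rewrite y'E [(y + d) i 0]mxE; have := d0 i; have := y0 i;
     rewrite !mxE; exact: addr_ge0.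
- by move=> i; rewrite y'E [(y + d) i 0]mxE lerDl; have := d0 i; rewrite mxE.
Qed.

Lemma newton_steps_subsolution z s : subsolution z ->
  let y := iter s (newton_step alpha Q v z) z in
  [/\ subsolution y, lecv z y
    & 1 - mass y <= (2 * alpha) ^+ s * (1 - mass z)].
Proof.
move=> z_sub y; have [z0 _ _] := z_sub.
rewrite {}/y; elim: s => [|s [y_sub zy gap]].
  by split=> //; rewrite expr0 mul1r.
have [y'_sub yy' gap'] := newton_step_subsolution z0 zy y_sub.
split=> // [i|]; first exact: le_trans (zy i) (yy' i).
apply: le_trans gap' _; rewrite exprS -[leRHS]mulrA ler_wpM2l //.
by rewrite mulr_ge0.
Qed.

Context (ns : nat -> nat) (x00 : 'cV[R]_n).
Hypothesis ns_gt0 : forall i, (0 < ns i)%N.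
Hypothesis x00_sub : subsolution x00.

Local Notation x := (newton_outer alpha Q v ns x00).

(** An outer step made of several inner steps gains a higher power of 2 alpha;
    one factor is enough, and at least one is there because [ns k > 0]. *)
Lemma newton_outer_subsolution k :
  subsolution (x k) /\ 1 - mass (x k) <= (2 * alpha) ^+ k * (1 - mass x00).
Proof.
elim: k => [|k [xk_sub gap]]; first by rewrite expr0 mul1r.
have [x'_sub _ gap'] := newton_steps_subsolution (ns k) xk_sub; split=> //.
apply: le_trans gap' _; rewrite exprS -[leRHS]mulrA.
have a2_ge0 : 0 <= 2 * alpha by rewrite mulr_ge0.
have xk1 : 0 <= 1 - mass (x k) by rewrite subr_ge0; case: xk_sub.
apply: (@le_trans _ _ (2 * alpha * (1 - mass (x k)))); last first.
  by rewrite ler_wpM2l.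
rewrite ler_wpM2r // -[leRHS]expr1; apply: ler_wiXn2l => //; exact: ltW.
Qed.

(** A subsolution has a residual of constant sign, so the absolute value of its
    mass bounds all its entries. *)
Lemma norm_pagerank_fun_le y : subsolution y -> `|F y| <= 1 - mass y.
Proof.
move=> [y0 y1 Fy]; rewrite -normrN.
have NFy : lecv 0 (- F y).
  by move=> i; have := Fy i; move: (F y) => w; rewrite !mxE oppr_ge0.
apply: le_trans (norm_le_mass NFy) _; rewrite massN mass_pagerank_fun opprK.
rewrite ler_piMr ?subr_ge0 // -addrA -opprD lerBlDr lerDl.
by rewrite addr_ge0 // mulr_ge0 // mass_ge0.
Qed.

Lemma pagerank_fun_newton_cvg : F (x k) @[k --> \oo] --> (0 : 'cV[R]_n).
Proof.
apply: norm_cvg0.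
apply: (@squeeze_cvgr _ _ _ _ (fun=> 0) (geometric (1 - mass x00) (2 * alpha))).
- apply: nearW => k; rewrite normr_ge0 /=.
  have [xk_sub gap] := newton_outer_subsolution k.
  by rewrite mulrC; exact: le_trans (norm_pagerank_fun_le xk_sub) gap.
- exact: cvg_cst.
- by apply: cvg_geometric; rewrite ger0_norm // mulr_ge0.
Qed.

End NewtonStep.

(** * Convergence for stochastic tensors *)

Lemma flattening_ge0 (R : realType) n (P : 'I_n -> 'I_n -> 'I_n -> R) i c :
  stochastic_tensor P -> 0 <= flattening P i c.
Proof. by case=> P_ge0 _; rewrite mxE. Qed.

Lemma flattening_col (R : realType) n (P : 'I_n -> 'I_n -> 'I_n -> R) c :
  stochastic_tensor P -> \sum_i flattening P i c = 1.
Proof. by case=> _ P_sum; under eq_bigr do rewrite mxE. Qed.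

Theorem theorem3p1 (R : realType) (n : nat) (hn : (1 <= n)%N)
    (P : 'I_n -> 'I_n -> 'I_n -> R) (hP : stochastic_tensor P)
    (alpha : R) (halpha0 : 0 <= alpha) (halpha : alpha < 1 / 2)
    (v : 'cV[R]_n) (hv : stochastic_vector v)
    (ns : nat -> nat) (hns : forall i, (0 < ns i)%N)
    (x00 : 'cV[R]_n)
    (hF : lecv (pagerank_fun alpha (flattening P) v x00) 0)
    (hx0 : lecv 0 x00) (hx1 : \sum_(i < n) x00 i 0 <= 1) :
  let x := modified_newton alpha (flattening P) v ns x00 in
  [/\ forall k, pagerank_deriv alpha (flattening P) (x k 0%N) \in unitmx,
      forall k, lecv (x k 0%N) (x k.+1 0%N)
    & pagerank_fun alpha (flattening P) v (x k 0%N) @[k --> \oo]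
        --> (0 : 'cV[R]_n)].
Proof.
have Q_ge0 i c := flattening_ge0 i c hP.
have Q_col c := flattening_col c hP.
have [_ v_mass] := hv.
have x00_sub : subsolution (flattening P) alpha v x00 by split.
have x_sub k := (newton_outer_subsolution Q_ge0 Q_col halpha0 halpha v_mass
  hns x00_sub k).1.
split.
- by move=> k; have [x0 x1 _] := x_sub k; exact: pagerank_deriv_unit.
- move=> k.
  by have [] := newton_steps_subsolution Q_ge0 Q_col halpha0 halpha v_mass
    (ns k) (x_sub k).
- exact: pagerank_fun_newton_cvg.
Qed.
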